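(* For every real $x\ge 1$, the following series converges and $$\Gamma(x)=x^{x-1}\sum_{n=1}^{\infty}(-1)^n\binom{x}{n}\sum_{k=1}^{n}(-1)^k\frac{k!}{k^k}\binom{n}{k}.$$ For instance, $$\Gamma\left(\tfrac32\right)=\frac{\sqrt{\pi}}{2}=\sqrt{\tfrac32}\left(\frac32-\frac{9}{16}-\frac{31}{288}-\frac{517}{12288}+\cdots\right),$$ where the displayed numbers in parentheses are the terms $n=1,2,3,4$ of the series at $x=\tfrac32$.
   Context: $\Gamma$ is the gamma function. For real $x$ and integer $n\ge 0$, $\binom{x}{n}=\frac{x(x-1)\cdots(x-n+1)}{n!}$. The infinite series is understood as the limit of its partial sums over $n$. *)

(* Defs.v *)
From HB Require Import structures.
From mathcomp Require Import all_boot all_order all_algebra.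
From mathcomp Require Import all_classical all_reals all_analysis.

Set Implicit Arguments.
Unset Strict Implicit.
Unset Printing Implicit Defensive.

Import Order.TTheory GRing.Theory Num.Theory.
Import numFieldNormedType.Exports.

Local Open Scope classical_set_scope.
Local Open Scope ring_scope.

(* Euler's integral. This is the gamma function for 0 < x only: for x <= 0 the
   integral diverges and [Rintegral] returns the junk value 0. *)
Definition Gamma (R : realType) (x : R) : R :=
  \int[@lebesgue_measure R]_(t in `]0%R, +oo[) (t `^ (x - 1) * expR (- t)).

Definition gbinom (R : realType) (x : R) (n : nat) : R :=
  (\prod_(i < n) (x - i%:R)) / n`!%:R.

Definition gamma_term (R : realType) (x : R) (n : nat) : R :=
  (-1) ^+ n * gbinom x n *
  \sum_(1 <= k < n.+1) (-1) ^+ k * (k`!%:R / k%:R ^+ k) * 'C(n, k)%:R.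

(* Main.v *)
Require Import Defs.
From HB Require Import structures.
From mathcomp Require Import all_boot all_order all_algebra.
From mathcomp Require Import all_classical all_reals all_analysis.
From mathcomp Require Import measurable_realfun ring lra.

(** The idea is that [Gamma x / x ^ (x - 1)] is [x] times the mean, under the
standard exponential law, of a fixed variable raised to the power [x - 1], so
that the claimed formula is the binomial series integrated term by term.

The substitution [t = x u] in Euler's integral gives
[[
  Gamma x = x ^ x * int_0^oo w(u) ^ (x - 1) e^(-u) du,   w(u) = u e^(-u),
]]
where [w] takes its values in ]0, 1] ([Gamma_exp_mean]). At a positive integer
[k] this reads [k! / k ^ k = k * int w ^ (k - 1) e^(-u)] ([poly_meanXn]). Hence
the inner alternating sum of the [n]-th term is the mean of
[sum_k (-1)^k k C(n, k) w ^ (k - 1) = - n (1 - w) ^ (n - 1)], and since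
[n C(x, n) = x C(x - 1, n - 1)] the term itself is [x] times the mean of
[(-1)^(n-1) C(x - 1, n - 1) (1 - w)^(n-1)] ([gamma_termS]). The partial sums are
thus [x] times the means of the Taylor polynomials at [1] of [w ^ y], for
[y = x - 1], and what remains is a uniform estimate of the error.

For [y > 0] the polynomial [Q] made of the terms of index at most [N] satisfies
[w Q' - y Q = - (-1)^N y C(y - 1, N) (1 - w)^N] ([newton_ode]). Put
[b = |C(y - 1, N)|]. Then [w ^ (-y) (Q + b)] and [w ^ (-y) (b - Q)] are both
nonincreasing on ]0, 1], and comparing with their values at [w = 1], where
[Q = 1], gives [|Q(w) - w ^ y| <= b] on all of ]0, 1] ([newton_bound]). Finally
[b] tends to [0] because it is, up to a constant, a product of factors
[1 - y / m], and the harmonic series diverges ([gbinom_cvg0]). For [y = 0] the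
series has a single nonzero term.

The value [Gamma (3/2) = sqrt pi / 2] reduces to the Gaussian integral, through
an explicit primitive of [sqrt t e^(-t)]. *)

Import Order.TTheory GRing.Theory Num.Theory.
Import numFieldNormedType.Exports.

Local Open Scope classical_set_scope.
Local Open Scope ring_scope.

(** * Generalized binomial coefficients and Newton polynomials *)

Lemma gbinom0 (R : realType) (y : R) : gbinom y 0 = 1.
Proof. by rewrite /gbinom big_ord0 divr1. Qed.

Lemma gbinomS (R : realType) (y : R) m :
  m.+1%:R * gbinom y m.+1 = (y - m%:R) * gbinom y m.
Proof.
rewrite /gbinom big_ord_recr /= factS natrM invfM.
have h : m.+1%:R != 0 :> R by rewrite pnatr_eq0.
have h' : m`!%:R != 0 :> R by rewrite pnatr_eq0 -lt0n fact_gt0.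
by field; rewrite h' nat1r.
Qed.

(** The absorption identity, which moves the exponent from [x] to [x - 1] in the
series, and from [y] to [y - 1] in the error term. *)
Lemma gbinomS_diag (R : realType) (y : R) m :
  m.+1%:R * gbinom y m.+1 = y * gbinom (y - 1) m.
Proof.
elim: m => [|m IH].
  by rewrite gbinomS !gbinom0 subr0.
rewrite gbinomS.
have h : m.+1%:R != 0 :> R by rewrite pnatr_eq0.
apply: (mulfI h); rewrite mulrCA IH [in RHS]mulrCA gbinomS.
by rewrite -natr1; ring.
Qed.

(** The first [N] terms of the binomial series of [w ^ y] at [w = 1]. *)
Definition newton {R : realType} (y : R) (N : nat) : {poly R} :=
  \sum_(m < N) ((-1) ^+ m * gbinom y m) *: (1 - 'X) ^+ m.

Lemma newtonS (R : realType) (y : R) N :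
  newton y N.+1 = newton y N + ((-1) ^+ N * gbinom y N) *: (1 - 'X) ^+ N.
Proof. by rewrite /newton big_ord_recr. Qed.

(** The differential equation [w f' = y f] of [w ^ y] holds for its Taylor
polynomials up to the last power of [1 - w], because all the lower ones cancel
in pairs. *)
Lemma newton_ode (R : realType) (y z : R) N :
  z * (newton y N.+1)^`().[z] - y * (newton y N.+1).[z]
  = - ((-1) ^+ N * (y * gbinom (y - 1) N) * (1 - z) ^+ N).
Proof.
rewrite -gbinomS_diag gbinomS.
elim: N => [|N IH].
  rewrite newtonS /newton big_ord0 add0r !gbinom0 !expr0 !mulr1 subr0 scale1r.
  by rewrite derivC !hornerE; ring.
rewrite newtonS derivD derivZ deriv_exp derivB derivC derivX sub0r.
rewrite !(hornerD, hornerZ, hornerMn, hornerM, hornerN, horner_exp).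
rewrite !(hornerX, hornerC).
rewrite !mulrDr opprD addrACA IH -gbinomS [N.+1.-1]/= -mulr_natr !exprS.
by ring.
Qed.

(** The derivative of the binomial expansion of [(1 - w) ^ m.+1]. *)
Lemma sum_alt_bin (R : comPzRingType) (w : R) (m : nat) :
  \sum_(1 <= k < m.+2) (-1) ^+ k * (k%:R * w ^+ k.-1) * 'C(m.+1, k)%:R
  = - (m.+1%:R * (1 - w) ^+ m).
Proof.
rewrite big_add1 /= exprBn mulr_sumr -sumrN big_mkord; apply: eq_bigr => k _.
rewrite expr1n mulr1 exprS -mulr_natr.
have /(congr1 (fun n => n%:R : R)) := mul_bin_diag m.+1 k.
rewrite !natrM /= => e.
transitivity (- ((-1) ^+ k * w ^+ k * (k.+1%:R * 'C(m.+1, k.+1)%:R))).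
  by ring.
by rewrite -e; ring.
Qed.

(** * Uniform convergence of the binomial series on ]0, 1] *)

(** A differential inequality [w q' <= y q] says that [w ^ (- y) q(w)] is
nonincreasing, hence at least its value at [1] everywhere on ]0, 1]. *)
Lemma powR_le_horner (R : realType) (q : {poly R}) (y w : R) :
  (forall z, 0 < z < 1 -> z * q^`().[z] <= y * q.[z]) ->
  0 < w <= 1 -> q.[1] * w `^ y <= q.[w].
Proof.
move=> hq /andP[w0 w1].
pose f (z : R) := z `^ (- y) * q.[z].
have df (z : R) : 0 < z ->
    is_derive z 1 f (z `^ (- y - 1) * (z * q^`().[z] - y * q.[z])).
  move=> z0.
  have d1 := is_derive1_powR (- y) z0.
  have d2 := is_derive_poly q z.
  apply: (is_derive_eq (is_deriveM d1 d2)).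
  rewrite /GRing.scale /=.
  have -> : z `^ (- y) = z * z `^ (- y - 1) :> R.
    have := @powRD R z (- y - 1) 1; rewrite subrK powRr1 ?ltW// mulrC => -> //.
    by rewrite (gt_eqF z0) implybT.
  by ring.
have : f 1 <= f w.
  apply: (@ler0_derive1_le_cc R f w 1) => //.
  - move=> z; rewrite in_itv /= => /andP[wz _].
    exact: (@ex_derive _ _ _ _ _ _ _ (df z (lt_trans w0 wz))).
  - move=> z; rewrite in_itv /= => /andP[wz z1].
    have z0 := lt_trans w0 wz.
    rewrite derive1E (@derive_val _ _ _ _ _ _ _ (df z z0)).
    by rewrite mulr_ge0_le0 ?powR_ge0// subr_le0 hq// z0.
  - apply: derivable_within_continuous => z; rewrite in_itv /= => /andP[wz _].
    exact: (@ex_derive _ _ _ _ _ _ _ (df z (lt_le_trans w0 wz))).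
  - by rewrite in_itv /= lexx ?w1.
  - by rewrite in_itv /= lexx ?w1.
rewrite /f powR1 mul1r powRN => h.
by rewrite -ler_pdivlMr ?powR_gt0// mulrC.
Qed.

Lemma newton1 (R : realType) (y : R) N : (newton y N.+1).[1] = 1.
Proof.
elim: N => [|N IH].
  by rewrite newtonS /newton big_ord0 add0r !hornerE gbinom0.
rewrite newtonS hornerD IH hornerZ horner_exp !hornerE.
by rewrite subrr expr0n mulr0 addr0.
Qed.

(** The bound does not depend on [w], which is what allows the series to be
integrated term by term without dominated convergence. *)
Lemma newton_bound (R : realType) (y w : R) N : 0 < y -> 0 < w <= 1 ->
  `|(newton y N.+1).[w] - w `^ y| <= `|gbinom (y - 1) N|.
Proof.
move=> y0 w01; set b := `|gbinom _ _|.
have b0 : 0 <= b by rewrite normr_ge0.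
have wy0 : 0 <= w `^ y by rewrite powR_ge0.
have ode z : 0 < z < 1 ->
    `|z * (newton y N.+1)^`().[z] - y * (newton y N.+1).[z]| <= y * b.
  move=> /andP[z0 z1].
  rewrite newton_ode normrN normrM normrX normrM normrM.
  rewrite normrX normrN1 expr1n mul1r (gtr0_norm y0) -mulrA ler_pM2l//.
  by rewrite ler_piMr// exprn_ile1// ger0_norm; lra.
(* Adding the constant [b] to [Q] or to [- Q] turns [w q' - y q] into
   something nonpositive, since it contributes [- y b]. *)
have h1 := @powR_le_horner _ (newton y N.+1 + b%:P) y w.
have h2 := @powR_le_horner _ (b%:P - newton y N.+1) y w.
rewrite !hornerE newton1 in h1 h2.
have {}h1 : (1 + b) * w `^ y <= (newton y N.+1).[w] + b.
  apply: h1 => // z z01; rewrite derivD derivC addr0 !hornerE mulrDr.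
  by have := ode z z01; rewrite ler_norml => /andP[_]; lra.
have {}h2 : (b - 1) * w `^ y <= b - (newton y N.+1).[w].
  apply: h2 => // z z01; rewrite derivB derivC sub0r !hornerE mulrBr.
  by have := ode z z01; rewrite ler_norml => /andP[+ _]; lra.
have bw : 0 <= b * w `^ y by rewrite mulr_ge0.
by rewrite ler_norml; apply/andP; split; lra.
Qed.

Lemma newton_exponent0 (R : realType) N : newton (0 : R) N.+1 = 1.
Proof.
elim: N => [|N IH].
  by rewrite newtonS /newton big_ord0 add0r gbinom0 !expr0 mulr1 scale1r.
rewrite newtonS IH.
suff -> : gbinom (0 : R) N.+1 = 0 by rewrite mulr0 scale0r addr0.
by rewrite /gbinom big_ord_recl /= subrr !mul0r.
Qed.

(** Past the index [y], each step multiplies [|gbinom (y - 1) m|] by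
[1 - y / m.+1 <= exp (- y / m.+1)], so the sequence is at most a constant times
[exp (- y H_m)], with [H_m] the harmonic sums. *)
Lemma gbinom_cvg0 (R : realType) (y : R) : 0 < y ->
  `|gbinom (y - 1) N| @[N --> \oo] --> 0.
Proof.
move=> y0.
pose H := series (@harmonic R).
have Hy : H n @[n --> \oo] --> +oo.
  apply: nondecreasing_dvgn_lt; last exact: dvg_harmonic.
  by apply/nondecreasing_series => n _ _; exact: harmonic_ge0.
(* From the index [M] on, the factor [1 - y / m.+1] is nonnegative. *)
pose M := Num.bound y.
pose C := `|gbinom (y - 1) M| * expR (y * H M).
have bnd n : `|gbinom (y - 1) (M + n)| <= C * expR (- (y * H (M + n)%N)).
  elim: n => [|n IH].
    by rewrite addn0 -mulrA -expRD subrr expR0 mulr1.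
  set m := (M + n)%N in IH *.
  have m0 : 0 < m.+1%:R :> R by rewrite ltr0n.
  have ym : y / m.+1%:R <= 1.
    rewrite ler_pdivrMr// mul1r ltW// (lt_le_trans (archi_boundP (ltW y0)))//.
    by rewrite ler_nat /m -addnS leq_addr.
  rewrite addnS -/m.
  have -> : gbinom (y - 1) m.+1 = - (1 - y / m.+1%:R) * gbinom (y - 1) m.
    apply: (mulfI (lt0r_neq0 m0)); rewrite gbinomS [in RHS]mulrA.
    congr (_ * gbinom _ _).
    by field; rewrite nat1r.
  have ym0 : 0 <= 1 - y / m.+1%:R by rewrite subr_ge0.
  have -> : C * expR (- (y * H m.+1))
      = expR (- (y / m.+1%:R)) * (C * expR (- (y * H m))).
    by rewrite /H seriesSr mulrDr opprD expRD mulrA mulrC.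
  rewrite normrM normrN (ger0_norm ym0).
  exact: (ler_pM ym0 (normr_ge0 _) (expR_ge1Dx _) IH).
rewrite -(cvg_shiftn M).
apply: (@squeeze_cvgr _ _ _ _ (cst 0)
  (fun n => C * expR (- (y * H (n + M)%N)))).
- by near=> n; rewrite normr_ge0 /= addnC bnd.
- exact: cvg_cst.
- rewrite -(mulr0 C); apply: cvgMl_tmp.
  apply: (@cvg_comp _ _ _ (fun n => y * H (n + M)%N) (fun z => expR (- z))
    _ (pinfty_nbhs R)); last exact: cvgr_expR.
  have HM : H (n + M)%N @[n --> \oo] --> +oo by rewrite (cvg_shiftn M H).
  apply/cvgryPge => A; move/cvgryPge : HM => /(_ (A / y)).
  by apply: filterS => n; rewrite ler_pdivrMr// mulrC.
Unshelve. all: by end_near. Qed.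

(** * Moments of the exponential law *)

Lemma continuous_expRN (R : realType) : continuous (fun u : R => expR (- u)).
Proof.
move=> u; apply: continuous_comp; first exact: opp_continuous.
exact: continuous_expR.
Qed.

Lemma is_derive_expRN (R : realType) (u : R) :
  is_derive u 1 (fun u => expR (- u)) (- expR (- u)).
Proof. by apply: trigger_derive; rewrite /GRing.scale /=; ring. Qed.

Lemma measurable_expRN (R : realType) (D : set R) :
  measurable_fun D (fun u : R => expR (- u)).
Proof.
by apply: measurable_funTS; apply: measurableT_comp.
Qed.

Lemma cvg_exprn_expRN (R : realType) n :
  t ^+ n * expR (- t) @[t --> +oo] --> (0 : R).
Proof.
apply: (@squeeze_cvgr _ _ _ _ (cst 0) (fun t => n.+1`!%:R * t^-1)).
- near=> t.
  have t0 : 0 < t by near: t; exact: nbhs_pinfty_gt.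
  apply/andP; split; first by rewrite mulr_ge0 ?exprn_ge0 ?expR_ge0 ?ltW.
  have f0 : 0 < n.+1`!%:R :> R by rewrite ltr0n fact_gt0.
  rewrite expRN ler_pdivrMr ?expR_gt0// mulrAC ler_pdivlMr// -exprSr.
  have := expR_ge1Dxn n (ltW t0); rewrite -ler_pdivrMl// mulrC.
  by apply: le_trans; rewrite lerDr.
- exact: cvg_cst.
- rewrite -(mulr0 n.+1`!%:R); apply: cvgMl_tmp.
  apply/gtr0_cvgV0; last exact: cvg_id.
  by near=> t; near: t; exact: nbhs_pinfty_gt.
Unshelve. all: by end_near. Qed.

(** Polynomials [p] such that [- p(t) e^(-t)] is a primitive of [t ^ n e^(-t)].
An explicit primitive gives the factorials directly, where integration by parts
over a half-line would meet an integrand without constant sign. *)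
Lemma exprn_expRN_primitive (R : realType) n : exists p : {poly R},
  [/\ p - p^`() = 'X ^+ n, p.[0] = n`!%:R &
      p.[t] * expR (- t) @[t --> +oo] --> (0 : R)].
Proof.
elim: n => [|n [p [pE p0 pcvg]]].
  exists 1; rewrite -[1]/(1%:P) derivC subr0 expr0 hornerC; split => //.
  by under eq_fun => t do rewrite hornerC -(expr0 t); exact: cvg_exprn_expRN.
exists ('X ^+ n.+1 + n.+1%:R *: p); split.
- by rewrite derivD derivXn derivZ /= -[_ ^+ n *+ _]scaler_nat -pE scalerBr
    subrK addrK.
- by rewrite hornerD hornerZ hornerXn p0 expr0n add0r factS natrM.
- under eq_fun do rewrite hornerD hornerZ hornerXn mulrDl -mulrA.
  have h := cvgD (cvg_exprn_expRN R n.+1) (@cvgMl_tmp _ _ _ _ _ n.+1%:R _ pcvg).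
  by rewrite mulr0 addr0 in h; exact: h.
Qed.

Lemma integral_exprn_expRN (R : realType) n :
  (\int[@lebesgue_measure R]_(t in `]0%R, +oo[) (t ^+ n * expR (- t))%:E)%E
  = n`!%:R%:E.
Proof.
have [p [pE p0 pcvg]] := exprn_expRN_primitive R n.
rewrite integral_itv_obnd_cbnd; last first.
  apply/measurable_EFinP; apply: measurable_funTS.
  apply: measurable_funM; first exact: exprn_measurable.
  exact: measurable_expRN.
have dF (t : R) :
    is_derive t 1 (fun t => - (p.[t] * expR (- t))) (t ^+ n * expR (- t)).
  have d1 := is_derive_poly p t.
  have d2 := is_derive_expRN _ t.
  apply: (is_derive_eq (is_deriveN (is_deriveM d1 d2))).
  have := congr1 (horner^~ t) pE; rewrite hornerD hornerN hornerXn => <-.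
  by rewrite /GRing.scale /=; ring.
rewrite (@ge0_continuous_FTC2y R _ (fun t => - (p.[t] * expR (- t))) 0 0) /=.
- by rewrite oppr0 expR0 p0 mulr1 -EFinB sub0r opprK.
- by move=> t t0; rewrite mulr_ge0 ?exprn_ge0 ?expR_ge0.
- apply: continuous_subspaceT => t.
  by apply: cvgM; [exact: exprn_continuous|exact: continuous_expRN].
- by rewrite -oppr0; exact: cvgN.
- by move=> t _; exact: (@ex_derive _ _ _ _ _ _ _ (dF t)).
- apply: cvg_at_right_filter.
  have /derivable1_diffP/differentiable_continuous :=
    @ex_derive _ _ _ _ _ _ _ (dF 0).
  exact.
- by move=> t _; rewrite derive1E (@derive_val _ _ _ _ _ _ _ (dF t)).
Qed.

Lemma Gamma_nat (R : realType) n : Gamma (n.+1%:R : R) = n`!%:R.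
Proof.
rewrite /Gamma -natr1 addrK -[RHS](congr1 fine (integral_exprn_expRN R n)).
apply: eq_Rintegral => t; rewrite inE /= in_itv /= andbT => t0.
by rewrite powR_mulrn ?ltW.
Qed.

(** * Means against the exponential law *)

(** The expectation of [f] under the exponential law of parameter 1, written as
an integral over the same half-line as Euler's. *)
Definition exp_mean {R : realType} (f : R -> R) : R :=
  \int[@lebesgue_measure R]_(u in `]0%R, +oo[) (f u * expR (- u)).

Lemma integral_expRN (R : realType) :
  (\int[@lebesgue_measure R]_(u in `]0%R, +oo[) (expR (- u))%:E)%E = 1%E.
Proof.
have := integral_exprn_expRN R 0; rewrite fact0 => <-.
by apply: eq_integral => u _; rewrite mul1r.
Qed.

Lemma integrable_expRN (R : realType) :
  (@lebesgue_measure R).-integrable `]0%R, +oo[ (fun u => (expR (- u))%:E).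
Proof.
apply/integrableP; split.
  by apply/measurable_EFinP; exact: measurable_expRN.
under eq_integral do rewrite gee0_abs ?lee_fin ?expR_ge0//.
by rewrite integral_expRN ltry.
Qed.

Lemma integrable_bounded_expRN (R : realType) (f : R -> R) (M : R) :
  measurable_fun setT f -> (forall u, 0 < u -> `|f u| <= M) ->
  (@lebesgue_measure R).-integrable `]0%R, +oo[
    (fun u => (f u * expR (- u))%:E).
Proof.
move=> mf fM.
have iM : (@lebesgue_measure R).-integrable `]0%R, +oo[
    (fun u => (M * expR (- u))%:E).
  exact: (integrableZl _ M (integrable_expRN R)).
apply: le_integrable iM => //.
  apply/measurable_EFinP; apply: measurable_funM; last exact: measurable_expRN.
  exact: measurable_funTS.
move=> u /=; rewrite in_itv /= andbT => u0.
rewrite lee_fin !normrM ler_wpM2r//.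
by rewrite (le_trans (fM u u0))// ler_norm.
Qed.

Lemma exp_mean_cst (R : realType) (c : R) : exp_mean (fun=> c) = c.
Proof.
rewrite /exp_mean RintegralZl//; last exact: integrable_expRN.
by rewrite /Rintegral integral_expRN mulr1.
Qed.

Lemma exp_mean_dist (R : realType) (f g : R -> R) (M e : R) :
  measurable_fun setT f -> measurable_fun setT g ->
  (forall u, 0 < u -> `|f u| <= M) -> (forall u, 0 < u -> `|g u| <= M) ->
  (forall u, 0 < u -> `|f u - g u| <= e) ->
  `|exp_mean f - exp_mean g| <= e.
Proof.
move=> mf mg fM gM fge.
have i1 := integrable_bounded_expRN _ _ _ mf fM.
have i2 := integrable_bounded_expRN _ _ _ mg gM.
have mh : measurable_fun setT (fun u => f u - g u) by exact: measurable_funB.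
have i3 := integrable_bounded_expRN _ _ _ mh fge.
have ie := @integrable_bounded_expRN R (cst e) `|e| (measurable_cst _)
  (fun _ _ => lexx _).
rewrite -RintegralB//.
rewrite (_ : \int[_]_(_ in _) _ =
   \int[@lebesgue_measure R]_(u in `]0%R, +oo[)
     ((f u - g u) * expR (- u))); last first.
  by apply: eq_Rintegral => u _; rewrite mulrBl.
apply: (le_trans (le_normr_Rintegral _ i3)) => //.
rewrite -[leRHS]exp_mean_cst; apply: le_Rintegral => //.
  exact: integrable_norm.
move=> u /=; rewrite in_itv /= andbT => u0.
by rewrite normrM (ger0_norm (expR_ge0 _)) ler_wpM2r ?expR_ge0// fge.
Qed.

(** The variable [w] whose powers are averaged. *)
Definition uexp {R : realType} (u : R) : R := u * expR (- u).

(** The upper bound comes from [u <= 1 + u <= exp u]. *)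
Lemma uexp_itv (R : realType) (u : R) : 0 < u -> 0 < uexp u <= 1.
Proof.
move=> u0; rewrite /uexp mulr_gt0 ?expR_gt0//= expRN ler_pdivrMr ?expR_gt0//.
by rewrite mul1r (le_trans _ (expR_ge1Dx u))// lerDr.
Qed.

Lemma measurable_uexp (R : realType) : measurable_fun [set: R] uexp.
Proof. by apply: measurable_funM => //; exact: measurable_expRN. Qed.

Definition poly_mean {R : realType} (p : {poly R}) : R :=
  exp_mean (fun u => p.[uexp u]).

(** A crude bound whose only use is the integrability of [p.[uexp u]]. *)
Lemma horner_norm_le (R : realType) (p : {poly R}) (w : R) :
  0 <= w <= 1 -> `|p.[w]| <= \sum_(i < size p) `|p`_i|.
Proof.
move=> /andP[w0 w1]; rewrite horner_coef.
apply: (le_trans (ler_norm_sum _ _ _)); apply: ler_sum => i _.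
by rewrite normrM ler_piMr// ger0_norm ?exprn_ge0// exprn_ile1.
Qed.

Lemma measurable_horner_uexp (R : realType) (p : {poly R}) :
  measurable_fun setT (fun u : R => p.[uexp u]).
Proof.
by apply: measurableT_comp; [exact: measurable_poly|exact: measurable_uexp].
Qed.

Lemma horner_uexp_bounded (R : realType) (p : {poly R}) (u : R) : 0 < u ->
  `|p.[uexp u]| <= \sum_(i < size p) `|p`_i|.
Proof.
move=> u0; have /andP[w0 w1] := uexp_itv _ _ u0.
by apply: horner_norm_le; rewrite (ltW w0).
Qed.

(** Linearity lets identities between polynomials, such as [sum_alt_bin] at
['X], be transported to the coefficients [k! / k ^ k]. *)
Lemma poly_mean_linear (R : realType) : linear (@poly_mean R : {poly R} -> R^o).
Proof.
move=> c p q; rewrite /poly_mean /exp_mean.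
have ip := integrable_bounded_expRN _ _ _ (measurable_horner_uexp _ p)
  (horner_uexp_bounded _ p).
have iq := integrable_bounded_expRN _ _ _ (measurable_horner_uexp _ q)
  (horner_uexp_bounded _ q).
rewrite /GRing.scale /= -RintegralZl//.
rewrite -RintegralD//; last first.
  exact: (integrableZl _ c ip).
by apply: eq_Rintegral => u _; rewrite hornerD hornerZ mulrDl mulrA.
Qed.

HB.instance Definition _ (R : realType) :=
  GRing.isLinear.Build R {poly R} R^o _ (@poly_mean R) (@poly_mean_linear R).

(** * The series as a mean of Newton polynomials *)

Lemma powR_cvg_right0 (R : realType) (y : R) : 0 <= y ->
  t `^ y @[t --> 0^'+] --> 0 `^ y.
Proof.
rewrite le_eqVlt => /predU1P[<-|y0]; last first.
  by rewrite powR0 ?gt_eqF//; exact: powR_cvg0.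
by under eq_fun do rewrite powRr0; rewrite powRr0; exact: cvg_cst.
Qed.

Lemma measurable_uexp_powR (R : realType) (y : R) :
  measurable_fun setT (fun u : R => uexp u `^ y).
Proof.
exact: (measurableT_comp (@measurable_powR R y) (measurable_uexp R)).
Qed.

Lemma uexp_powR_le1 (R : realType) (y u : R) : 0 <= y -> 0 < u ->
  `|uexp u `^ y| <= 1.
Proof.
move=> y0 /uexp_itv/andP[w0 w1].
rewrite ger0_norm ?powR_ge0//; have -> : 1 = 1 `^ y :> R by rewrite powR1.
by apply: ge0_ler_powR => //; rewrite nnegrE ltW.
Qed.

(** The substitution [t = x u]. Since the exponential factor becomes
[exp (- x u) = exp (- u) ^ (x - 1) * exp (- u)], one copy of [exp (- u)] is left
as the weight and the rest completes [u ^ (x - 1)] into a power of [uexp u]. *)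
Lemma Gamma_exp_mean (R : realType) (x : R) : 1 <= x ->
  Gamma x = x `^ x * exp_mean (fun u => uexp u `^ (x - 1)).
Proof.
move=> x1; have x0 : 0 < x by apply: lt_le_trans x1.
pose G (t : R) := t `^ (x - 1) * expR (- t).
have mG : measurable_fun [set: R] G.
  by apply: measurable_funM; [exact: measurable_powR|exact: measurable_expRN].
have derF : (fun u : R => x * u)^`()%classic = cst x.
  by apply/funext => u; rewrite derive1Ml// derive1_id mulr1.
have -> : Gamma x
    = fine (\int[@lebesgue_measure R]_(t in `[0%R, +oo[) (G t)%:E)%E.
  rewrite /Gamma /Rintegral integral_itv_obnd_cbnd//.
  exact/measurable_EFinP/measurable_funTS.
have subst : (\int[@lebesgue_measure R]_(t in `[0%R, +oo[) (G t)%:E)%E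
   = (\int[@lebesgue_measure R]_(u in `[0%R, +oo[) (G (x * u) * x)%:E)%E.
  have := @increasing_ge0_integration_by_substitutiony R (fun u => x * u) G 0.
  rewrite derF mulr0; apply.
  - by move=> u v _ _ uv; rewrite ltr_pM2l.
  - by move=> u _; exact: cvg_cst.
  - exact: is_cvg_cst.
  - exact: is_cvg_cst.
  - split; first by move=> u _; exact: ex_derive.
    by apply: cvg_at_right_filter; apply: cvgMl_tmp; exact: cvg_id.
  - by apply: (@gt0_cvgMry _ _ _ x _ x0); exact: cvg_id.
  - apply/continuous_within_itvcyP; split.
      move=> t; rewrite in_itv /= andbT => t0.
      have ct : {for t, continuous (@powR R ^~ (x - 1))}.
        apply: differentiable_continuous; apply/derivable1_diffP.
        by apply: derivable_powR; rewrite in_itv /= andbT.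
      by apply: cvgM; [exact: ct|exact: continuous_expRN].
    apply: cvgM; first by apply: powR_cvg_right0; rewrite subr_ge0.
    by apply: cvg_at_right_filter; exact: continuous_expRN.
  - by move=> t _; rewrite mulr_ge0 ?powR_ge0 ?expR_ge0.
rewrite subst -integral_itv_obnd_cbnd; last first.
  apply/measurable_EFinP; apply: measurable_funM => //.
  exact: measurable_funTS (measurableT_comp mG (mulrl_measurable x)).
rewrite -RintegralZl//; last first.
  apply: (integrable_bounded_expRN _ _ 1 (measurable_uexp_powR _ _)) => u.
  by apply: uexp_powR_le1; rewrite subr_ge0.
apply: eq_Rintegral => u; rewrite inE /= in_itv /= andbT => u0.
have u0' := ltW u0.
rewrite /G /uexp !powRM ?expR_ge0 ?(ltW x0)// -(mulr_powRB1 (ltW x0) x0).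
have -> : expR (- (x * u)) = expR (- u) `^ (x - 1) * expR (- u).
  by rewrite -expRM -expRD; congr expR; ring.
by ring.
Qed.

(** [Gamma_exp_mean] at a positive integer, where [Gamma] is a factorial. *)
Lemma poly_meanXn (R : realType) k :
  (k.+1`!%:R / k.+1%:R ^+ k.+1 : R) = k.+1%:R * poly_mean 'X^k.
Proof.
have k0 : k.+1%:R ^+ k.+1 != 0 :> R by rewrite expf_eq0 pnatr_eq0.
have := @Gamma_exp_mean R k.+1%:R; rewrite ler1n => /(_ isT).
rewrite Gamma_nat factS natrM powR_mulrn// => ->.
rewrite -mulrA mulrAC divff// mul1r; congr (_ * _).
apply: eq_Rintegral => u; rewrite inE /= in_itv /= andbT => u0.
have /andP[w0 _] := uexp_itv _ _ u0.
by rewrite hornerXn -[in X in _ `^ (X - 1)]natr1 addrK powR_mulrn// ltW.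
Qed.

Lemma gamma_termS (R : realType) (x : R) m :
  gamma_term x m.+1
  = x * poly_mean (((-1) ^+ m * gbinom (x - 1) m) *: (1 - 'X) ^+ m).
Proof.
rewrite /gamma_term.
have -> : \sum_(1 <= k < m.+2) (-1) ^+ k * (k`!%:R / k%:R ^+ k) * 'C(m.+1, k)%:R
    = poly_mean (- (m.+1%:R *: (1 - 'X) ^+ m)) :> R.
  have -> : - (m.+1%:R *: (1 - 'X) ^+ m)
      = \sum_(1 <= k < m.+2) ((-1) ^+ k * k%:R * 'C(m.+1, k)%:R) *: 'X^(k.-1)
      :> {poly R}.
    rewrite -mul_polyC polyC_natr -sum_alt_bin; apply: eq_bigr => k _.
    by rewrite -mul_polyC !polyCM polyC_exp polyCN !polyC_natr; ring.
  rewrite linear_sum; apply: eq_big_nat => -[//|k] _.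
  by rewrite linearZ /= poly_meanXn /GRing.scale /=; ring.
rewrite linearN !linearZ /= /GRing.scale /= exprS.
set L := poly_mean _.
transitivity ((-1) ^+ m * (m.+1%:R * gbinom x m.+1) * L); first by ring.
by rewrite gbinomS_diag; ring.
Qed.

Lemma gamma_partial_sum (R : realType) (x : R) N :
  \sum_(1 <= n < N.+1) gamma_term x n = x * poly_mean (newton (x - 1) N).
Proof.
rewrite big_add1 /= /newton linear_sum mulr_sumr big_mkord.
by apply: eq_bigr => m _; exact: gamma_termS.
Qed.

Lemma newton_mean_dist (R : realType) (y : R) N : 0 < y ->
  `|poly_mean (newton y N.+1) - exp_mean (fun u => uexp u `^ y)|
  <= `|gbinom (y - 1) N|.
Proof.
move=> y0.
set b := `|gbinom _ _|; pose q := newton y N.+1.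
pose M := 1 + \sum_(i < size q) `|q`_i|.
have S0 : 0 <= \sum_(i < size q) `|q`_i| by apply: sumr_ge0.
apply: (exp_mean_dist _ _ _ M _ (measurable_horner_uexp _ q)
  (measurable_uexp_powR _ y)) => u u0.
- by rewrite (le_trans (horner_uexp_bounded _ q u u0))// lerDr.
- by rewrite (le_trans (uexp_powR_le1 _ _ _ (ltW y0) u0))// lerDl.
- exact: newton_bound (uexp_itv _ _ u0).
Qed.

(** The value [x = 1] is apart: there [y = 0] and [|gbinom (y - 1) N| = 1] does
not tend to [0], but the nonempty Newton polynomials are all [1]. *)
Lemma gamma_series_cvg (R : realType) (x : R) : 1 <= x ->
  (\sum_(1 <= n < N) gamma_term x n) @[N --> \oo]
  --> x * exp_mean (fun u => uexp u `^ (x - 1)).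
Proof.
move=> x1.
(* The sum over [1 <= n < N.+2] is given by [newton _ N.+1]. *)
rewrite -(cvg_shiftn 2).
under eq_fun do rewrite addn2 gamma_partial_sum.
apply: cvgMl_tmp.
have [->|xneq1] := eqVneq x 1.
  rewrite subrr (_ : (fun u : R => uexp u `^ 0) = cst 1); last first.
    by apply/funext => u; rewrite powRr0.
  under eq_fun do rewrite newton_exponent0.
  rewrite (_ : poly_mean 1 = exp_mean (cst 1)); first exact: cvg_cst.
  by congr exp_mean; apply/funext => u; rewrite hornerE.
have y0 : 0 < x - 1 by rewrite subr_gt0 lt_neqAle eq_sym xneq1.
apply/cvgrPdist_le => e e0.
have := gbinom_cvg0 _ _ y0 => /cvgrPdist_le/(_ e e0).
apply: filterS => N; rewrite sub0r normrN normr_id => h.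
by rewrite distrC (le_trans (newton_mean_dist _ _ _ y0)).
Qed.

(** * The value at 3/2 *)

Local Notation gauss_int := gauss_integral_proof.integral0_gauss.

Lemma cvg_sqrty (R : realType) :
  Num.sqrt t @[t --> +oo] --> (+oo : set_system R).
Proof.
apply/cvgryPge => A; near=> t.
have At : A ^+ 2 <= t by near: t; apply: nbhs_pinfty_ge; exact: num_real.
by rewrite (le_trans (ler_norm A))// -sqrtr_sqr ler_wsqrtr.
Unshelve. all: by end_near. Qed.

Lemma cvg_integral0_gauss (R : realType) :
  @gauss_int R t @[t --> +oo] --> Num.sqrt pi / 2.
Proof.
have -> : Num.sqrt pi / 2 = Num.sqrt (pi / 4) :> R.
  rewrite sqrtrM ?pi_ge0//; congr (_ * _).
  have -> : 4^-1 = 2^-1 ^+ 2 :> R by field.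
  by rewrite sqrtr_sqr ger0_norm.
have -> : @gauss_int R = fun t => Num.sqrt (gauss_int t ^+ 2).
  apply/funext => t; rewrite sqrtr_sqr ger0_norm//.
  exact: gauss_integral_proof.integral0_gauss_ge0.
apply: continuous_cvg; first exact: sqrt_continuous.
exact: gauss_integral_proof.cvg_integral0_gauss_sqr.
Qed.

Lemma integrable_gauss (R : realType) (a b : R) :
  (@lebesgue_measure R).-integrable `[a, b] (EFin \o @gauss_fun R).
Proof. by apply: integrableS integrableT_gauss. Qed.

(** The bound [s + 1] only provides an interval with [s] in its interior. *)
Lemma is_derive_integral0_gauss (R : realType) (s : R) : 0 < s ->
  is_derive s 1 (@gauss_int R) (expR (- s ^+ 2)).
Proof.
move=> s0.
have s1 : s < s + 1 by rewrite ltrDl.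
have [d1 d2] := continuous_FTC1_closed s1 (integrable_gauss _ 0 (s + 1)) s0
  (@continuous_gauss_fun R s).
by apply: DeriveDef; [exact: d1|rewrite -derive1E; exact: d2].
Qed.

(** The derivative of [gauss_int (sqrt t)] is [e^(-t) / (2 sqrt t)], which is
cancelled by part of the derivative of [- sqrt t e^(-t)]. What is left is
the integrand [sqrt t e^(-t)], which is nonnegative, and the boundary values
are those of the Gaussian integral. *)
Lemma Gamma_three_halves (R : realType) : Gamma (3 / 2 : R) = Num.sqrt pi / 2.
Proof.
pose f (t : R) := Num.sqrt t * expR (- t).
pose F (t : R) := gauss_int (Num.sqrt t) - Num.sqrt t * expR (- t).
have cf : continuous f.
  by move=> t; apply: cvgM; [exact: sqrt_continuous|exact: continuous_expRN].
have -> : Gamma (3 / 2 : R) = \int[@lebesgue_measure R]_(t in `]0%R, +oo[) f t.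
  apply: eq_Rintegral => t; rewrite inE /= in_itv /= andbT => t0.
  by rewrite (_ : 3 / 2 - 1 = 2^-1 :> R) ?powR12_sqrt ?ltW//; field.
have dF (t : R) : 0 < t -> is_derive t 1 F (f t).
  move=> t0; have s0 : 0 < Num.sqrt t by rewrite sqrtr_gt0.
  have ds := is_derive1_sqrt t0.
  have dI := is_derive_integral0_gauss R _ s0.
  have d1 : is_derive t 1 (gauss_int \o @Num.sqrt R)
      (expR (- Num.sqrt t ^+ 2) * (2 * Num.sqrt t)^-1).
    exact: is_derive1_comp.
  have de := is_derive_expRN _ t.
  apply: (is_derive_eq (is_deriveB d1 (is_deriveM ds de))).
  rewrite /f /GRing.scale /= sqr_sqrtr ?ltW//; field.
  by rewrite gt_eqF.
have F0 : F 0 = 0.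
  rewrite /F sqrtr0 mul0r subr0 /gauss_integral_proof.integral0_gauss.
  by rewrite set_itv1 Rintegral_set1.
have Fy : F t @[t --> +oo] --> Num.sqrt pi / 2.
  have h1 : @gauss_int R (Num.sqrt t) @[t --> +oo] --> Num.sqrt pi / 2.
    exact: (cvg_comp (@Num.sqrt R) _ (@cvg_sqrty R) (@cvg_integral0_gauss R)).
  have h2 : Num.sqrt t * expR (- t) @[t --> +oo] --> (0 : R).
    apply: (@squeeze_cvgr _ _ _ _ (cst 0) (fun t => t ^+ 1 * expR (- t))).
    - near=> t.
      have t1 : 1 <= t by near: t; apply: nbhs_pinfty_ge; exact: num_real.
      rewrite /= mulr_ge0 ?sqrtr_ge0 ?expR_ge0//= ler_wpM2r ?expR_ge0//.
      have t0 : 0 <= t by apply: le_trans t1.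
      rewrite expr1 -[leRHS](ger0_norm t0) -sqrtr_sqr ler_wsqrtr//.
      by rewrite expr2 ler_peMl.
    - exact: cvg_cst.
    - exact: cvg_exprn_expRN.
  by have := cvgB h1 h2; rewrite subr0; exact.
rewrite /Rintegral integral_itv_obnd_cbnd; last first.
  apply/measurable_EFinP; apply: measurable_funTS.
  exact: continuous_measurable_fun.
rewrite (@ge0_continuous_FTC2y R f F 0 (Num.sqrt pi / 2)) ?F0 ?sube0//.
- by move=> t t0; rewrite mulr_ge0 ?sqrtr_ge0 ?expR_ge0.
- exact: continuous_subspaceT.
- by move=> t t0; exact: (@ex_derive _ _ _ _ _ _ _ (dF t t0)).
- have h1 : @gauss_int R (Num.sqrt t) @[t --> (0:R)^'+] --> (0 : R).
    have I0 := @parameterized_integral_cvg_left R 0 1 (@gauss_fun R) ltr01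
      (integrable_gauss _ 0 1).
    have s0 : Num.sqrt t @[t --> (0:R)^'+] --> (0 : R).
      apply: cvg_at_right_filter.
      by have := @sqrt_continuous R 0; rewrite /continuous_at sqrtr0; exact.
    exact: (@cvg_comp _ _ _ (@Num.sqrt R) (@gauss_int R) _ _ _ s0 I0).
  have h2 : Num.sqrt t * expR (- t) @[t --> (0:R)^'+] --> (0 : R).
    apply: cvg_at_right_filter.
    by have := @cf 0; rewrite /continuous_at /f sqrtr0 mul0r; exact.
  by have := cvgB h1 h2; rewrite subr0; exact.
- move=> t; rewrite in_itv /= andbT => t0.
  by rewrite derive1E (@derive_val _ _ _ _ _ _ _ (dF t t0)).
Unshelve. all: by end_near. Qed.

(** * The theorem *)

Lemma gamma_term_three_halves (R : realType) :
  [/\ gamma_term (3 / 2 : R) 1 = 3 / 2,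
      gamma_term (3 / 2 : R) 2 = - (9 / 16),
      gamma_term (3 / 2 : R) 3 = - (31 / 288) &
      gamma_term (3 / 2 : R) 4 = - (517 / 12288)].
Proof.
by split; rewrite /gamma_term /gbinom big_add1 /= big_mkord !big_ord_recr /=
  !big_ord0 !(factS, fact0) !(bin0, bin1, binn, binS); field.
Qed.

Theorem theorem2p6 (R : realType) :
  (forall x : R, 1 <= x ->
     cvgn (fun N : nat => \sum_(1 <= n < N) gamma_term x n) /\
     Gamma x
       = x `^ (x - 1) * limn (fun N : nat => \sum_(1 <= n < N) gamma_term x n)) /\
  (Gamma (3 / 2 : R) = Num.sqrt pi / 2 /\
   Num.sqrt pi / 2
     = Num.sqrt (3 / 2)
       * limn (fun N : nat => \sum_(1 <= n < N) gamma_term (3 / 2 : R) n) /\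
   gamma_term (3 / 2 : R) 1 = 3 / 2 /\
   gamma_term (3 / 2 : R) 2 = - (9 / 16) /\
   gamma_term (3 / 2 : R) 3 = - (31 / 288) /\
   gamma_term (3 / 2 : R) 4 = - (517 / 12288)).
Proof.
have series (x : R) : 1 <= x ->
    cvgn (fun N : nat => \sum_(1 <= n < N) gamma_term x n) /\
    Gamma x
      = x `^ (x - 1) * limn (fun N : nat => \sum_(1 <= n < N) gamma_term x n).
  move=> x1; have x0 : 0 < x by apply: lt_le_trans x1.
  have cvgS := gamma_series_cvg _ _ x1.
  split.
    by apply/cvg_ex; exists (x * exp_mean (fun u => uexp u `^ (x - 1))).
  rewrite (cvg_lim _ cvgS)// Gamma_exp_mean//.
  by rewrite mulrCA mulrA mulr_powRB1// ltW.
split=> //; rewrite Gamma_three_halves; split=> //.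
have [t1 t2 t3 t4] := gamma_term_three_halves R.
split; last by [].
have h1 : 1 <= 3 / 2 :> R by lra.
have [_] := series _ h1; rewrite Gamma_three_halves => {1}->; congr (_ * _).
rewrite (_ : 3 / 2 - 1 = 2^-1 :> R); last by field.
by rewrite powR12_sqrt// divr_ge0.
Qed.
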